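(* Let $\mathbf{B}=\{z\in\mathbb{D}^\infty:z_j\to0\}$ be the open unit ball of $c_0$ and let $\phi=(\phi_j)_{j\ge1}:\mathbf{B}\to\mathbf{B}$ be an analytic map such that $C_\phi f=f\circ\phi$ maps $A^+(\mathbb{T}^\infty)$ into itself. If $C_\phi$ is an isometric automorphism of $A^+(\mathbb{T}^\infty)$, then $\phi(z)=(\epsilon_jz_{\sigma(j)})_{j\ge1}$ for some permutation $\sigma$ of $\mathbb{N}$ and some sequence $(\epsilon_j)_{j\ge1}$ of complex numbers of modulus $1$.
   Context: $A^+(\mathbb{T}^\infty)$ is the algebra of functions $f(z)=\sum_\alpha a_\alpha z^\alpha$ on $\overline{\mathbb{D}}^\infty$, $\alpha$ ranging over finitely supported sequences of non-negative integers, with $\|f\|=\sum|a_\alpha|<\infty$; a Banach algebra under pointwise multiplication. Analyticity on $\mathbf{B}$ is in the sense of holomorphic maps on the Banach space $c_0$. An automorphism is a bijective algebra homomorphism onto $A^+(\mathbb{T}^\infty)$. *)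

(* Defs.v *)
From HB Require Import structures.
From mathcomp Require Import all_boot all_order all_algebra.
From mathcomp Require Import complex.
From mathcomp Require Import all_classical all_reals all_analysis.
Set Implicit Arguments. Unset Strict Implicit. Unset Printing Implicit Defensive.
Import Order.TTheory GRing.Theory Num.Theory.
Local Open Scope classical_set_scope.
Local Open Scope ring_scope.

Definition cnorm (R : rcfType) (z : R[i]%C) : R := ComplexField.Normc.normc z.

Section Aplus.
Variable R : realType.
Local Notation C := (R[i])%C.
Local Notation nc := (@cnorm R).

(* multi-indices: sequences of non-negative integers; the relevant ones are
   the finitely supported ones *)
Definition support (al : nat -> nat) : set nat := [set j | al j != 0%N].
Definition fin_supp (al : nat -> nat) : Prop := finite_set (support al).

Definition mono (al : nat -> nat) (z : nat -> C) : C :=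
  \big[*%R/1%R]_(j \in support al) (z j ^+ al j).

Definition HasSum (I : choiceType) (u : I -> C) (s : C) : Prop :=
  forall e : R, 0 < e -> exists F0 : set I, finite_set F0 /\
    forall F : set I, finite_set F -> F0 `<=` F ->
      nc (\sum_(i \in F) u i - s) < e.

Definition cpolydisc (z : nat -> C) : Prop := forall j, nc (z j) <= 1.

Definition c0 (z : nat -> C) : Prop :=
  forall e : R, 0 < e -> exists N : nat, forall j, (N <= j)%N -> nc (z j) < e.
Definition inB (z : nat -> C) : Prop := (forall j, nc (z j) < 1) /\ c0 z.

Definition coef_family (a : (nat -> nat) -> C) : Prop :=
  (forall al, ~ fin_supp al -> a al = 0) /\
  (\esum_(al in [set: nat -> nat]) ((nc (a al))%:E) < +oo)%E.

Definition represents (a : (nat -> nat) -> C) (f : (nat -> C) -> C) : Prop :=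
  forall z, cpolydisc z -> HasSum (fun al => a al * mono al z) (f z).

Definition Aplus (f : (nat -> C) -> C) : Prop :=
  exists a, coef_family a /\ represents a f.

(* the norm ||f|| = sum_al |a_al| (the coefficients are unique) *)
Definition Anorm (f : (nat -> C) -> C) : \bar R :=
  ereal_inf [set (\esum_(al in [set: nat -> nat]) ((nc (a al))%:E))%E
            | a in [set a | coef_family a /\ represents a f]].

Definition supn (h : nat -> C) : \bar R :=
  ereal_sup (range (fun j => (nc (h j))%:E)).

Definition holo_B (phi : (nat -> C) -> (nat -> C)) : Prop :=
  forall z, inB z -> exists L : (nat -> C) -> (nat -> C),
    (forall h, c0 h -> c0 (L h)) /\
    (forall (a b : C) h k, c0 h -> c0 k ->
        L (fun j => a * h j + b * k j) = (fun j => a * L h j + b * L k j)) /\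
    (exists M : R, forall h, c0 h -> (supn (L h) <= M%:E * supn h)%E) /\
    (forall e : R, 0 < e -> exists d : R, 0 < d /\
       forall h, c0 h -> inB (fun j => z j + h j) -> (supn h < d%:E)%E ->
         (supn (fun j => (phi (fun i => z i + h i) j - phi z j - L h j)%R)
            <= e%:E * supn h)%E).

End Aplus.

(* Main.v *)
(* [C_phi] is an isometry of [l^1], indexed by the monomials, onto itself, so it
   sends [z_j], an extreme point of the unit ball, to an extreme point: [phi_j]
   is a unimodular multiple [eps_j z^(be_j)] of a monomial. Each [z_j] must
   occur among these monomials, as otherwise [|phi (r e_j)| <= r ^ 2], which is
   too small for [z_j] to lie in the range of [C_phi]. Injectivity then forbids
   any repetition and any further monomial. *)

Require Import Defs.
From HB Require Import structures.
From mathcomp Require Import all_boot all_order all_algebra.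
From mathcomp Require Import complex lra.
From mathcomp Require Import all_classical all_reals all_analysis.
Import Order.TTheory GRing.Theory Num.Theory.
Import numFieldNormedType.Exports.
Local Open Scope classical_set_scope.
Local Open Scope ring_scope.
Set Implicit Arguments.
Unset Strict Implicit.

(** * Modulus of complex numbers *)

Section Modulus.
Variable R : realType.
Implicit Types x y : R[i].

Lemma cnorm_ge0 x : 0 <= cnorm x.
Proof. by case: x => a b; exact: sqrtr_ge0. Qed.

Lemma cnormM x y : cnorm (x * y) = cnorm x * cnorm y.
Proof. exact: ComplexField.Normc.normcM. Qed.

Lemma cnorm0 : cnorm (0 : R[i]) = 0.
Proof. exact: ComplexField.Normc.normc0. Qed.

Lemma cnorm1 : cnorm (1 : R[i]) = 1.
Proof. exact: ComplexField.Normc.normc1. Qed.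

Lemma cnorm_eq0 x : (cnorm x == 0) = (x == 0).
Proof.
by apply/eqP/eqP => [/ComplexField.Normc.eq0_normc//|->]; rewrite cnorm0.
Qed.

Lemma cnormV x : cnorm x^-1 = (cnorm x)^-1.
Proof. exact: ComplexField.Normc.normcV. Qed.

Lemma cnormN x : cnorm (- x) = cnorm x.
Proof. exact: normcN. Qed.

Lemma cnormD x y : cnorm (x + y) <= cnorm x + cnorm y.
Proof. exact: le_normcD. Qed.

Lemma cnormX x n : cnorm (x ^+ n) = cnorm x ^+ n.
Proof. by elim: n => [|n IH]; rewrite ?expr0 ?cnorm1// !exprS cnormM IH. Qed.

Lemma cnorm_real (r : R) : 0 <= r -> cnorm (r%:C)%C = r.
Proof. by move=> r0; rewrite /cnorm /= expr0n addr0 sqrtr_sqr ger0_norm. Qed.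

Lemma cnorm_fsum (I : choiceType) (F : set I) (u : I -> R[i]) :
  finite_set F -> cnorm (\sum_(i \in F) u i) <= \sum_(i \in F) cnorm (u i).
Proof.
move=> finF; rewrite !fsbig_finite//.
elim/big_rec2: _ => [|i r x _ le]; first by rewrite cnorm0.
by rewrite (le_trans (cnormD _ _))// lerD2l.
Qed.

End Modulus.

(** * Absolute and unordered sums of complex families *)

Section Summation.
Variables (R : realType) (I : choiceType).
Implicit Types (u v : I -> R[i]) (M : R).

Definition absum u : \bar R := (\esum_(i in [set: I]) (cnorm (u i))%:E)%E.

Lemma absum_ge0 u : (0 <= absum u)%E.
Proof. by apply: esum_ge0 => i _; rewrite lee_fin cnorm_ge0. Qed.

(** The extended sum is a supremum of finite partial sums; later estimates can therefore be made on
    finite sums of real numbers. *)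
Lemma absum_leP u M :
  (absum u <= M%:E)%E <->
  forall F : set I, finite_set F -> \sum_(i \in F) cnorm (u i) <= M.
Proof.
split=> [le F finF|le].
  rewrite -lee_fin -fsumEFin//; apply: le_trans le.
  by apply: esum_ge; exists F.
apply: ge_ereal_sup => _ [F [finF _] <-].
by rewrite fsumEFin// lee_fin le.
Qed.

Lemma absum_finP u : (absum u < +oo)%E -> exists2 M, 0 <= M & absum u = M%:E.
Proof.
move: (absum_ge0 u); case: (absum u) => [M| |]//=; rewrite lee_fin => M0 _.
by exists M.
Qed.

Lemma absum_le u v M k : 0 <= k -> (forall i, cnorm (v i) <= k * cnorm (u i)) ->
  (absum u <= M%:E)%E -> (absum v <= (k * M)%:E)%E.
Proof.
move=> k0 le /absum_leP uM; apply/absum_leP => F finF.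
apply: (@le_trans _ _ (\sum_(i \in F) k * cnorm (u i))).
  by rewrite !fsbig_finite//; apply: ler_sum.
by rewrite -mulr_fsumr ler_wpM2l// uM.
Qed.

Lemma absum_lin c u v M N : (absum u <= M%:E)%E -> (absum v <= N%:E)%E ->
  (absum (fun i => c * u i + v i)%R <= (cnorm c * M + N)%:E)%E.
Proof.
move=> /absum_leP uM /absum_leP vN; apply/absum_leP => F finF.
apply: (@le_trans _ _
    (\sum_(i \in F) (cnorm c * cnorm (u i) + cnorm (v i)))).
  rewrite !fsbig_finite//; apply: ler_sum => i _.
  by rewrite (le_trans (cnormD _ _))// cnormM.
by rewrite fsbig_split// -mulr_fsumr lerD// ?ler_wpM2l ?cnorm_ge0 ?uM ?vN.
Qed.

Definition delta k (c : R[i]) : I -> R[i] := fun i => if i == k then c else 0.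

Lemma fsum_delta (F : set I) k c : finite_set F -> F k ->
  \sum_(i \in F) delta k c i = c.
Proof.
move=> finF Fk; rewrite (fsbigD1 k)//= [X in _ + X]fsbig1 ?addr0.
  by rewrite /delta eqxx.
by move=> i [_ /eqP/negPf ik]; rewrite /delta ik.
Qed.

Lemma absum_delta k c : absum (delta k c) = (cnorm c)%:E.
Proof.
rewrite -(@esum_set1 R I k (fun=> (cnorm c)%:E)) ?lee_fin ?cnorm_ge0//.
rewrite /absum [RHS]esum_mkcond; apply: eq_esum => i _.
rewrite /delta; have [->|/eqP ik] := eqVneq i k; first by rewrite mem_set.
by rewrite memNset// cnorm0.
Qed.

Lemma HasSum_delta k c : HasSum (delta k c) c.
Proof.
move=> e e0; exists [set k]; split=> [|F finF kF]; first exact: finite_set1.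
by rewrite fsum_delta ?subrr ?cnorm0//; exact: kF.
Qed.

Lemma HasSum_lin c u v s t :
  HasSum u s -> HasSum v t -> HasSum (fun i => c * u i + v i) (c * s + t).
Proof.
(* Chosen so that [cnorm c * d + d = e]; the [+ 1] also covers [c = 0]. *)
move=> us vt e e0; set d := e / (cnorm c + 1).
have c1 : 0 < cnorm c + 1 by rewrite ltr_wpDl// cnorm_ge0.
have [|F [finF FP]] := us d; first by rewrite divr_gt0.
have [|G [finG GP]] := vt d; first by rewrite divr_gt0.
exists (F `|` G); split=> [|H finH FGH]; first by rewrite finite_setU.
rewrite fsbig_split// -mulr_fsumr opprD addrACA -mulrBr.
rewrite (le_lt_trans (cnormD _ _))// cnormM.
have -> : e = cnorm c * d + d by rewrite -[X in _ + X]mul1r -mulrDl mulrC divfK// gt_eqF.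
apply: ler_ltD; last by apply: GP => // i Gi; apply: FGH; right.
rewrite ler_wpM2l ?cnorm_ge0// ltW//.
by apply: FP => // i Fi; apply: FGH; left.
Qed.

Lemma HasSum_norm u s M : HasSum u s -> (absum u <= M%:E)%E -> cnorm s <= M.
Proof.
move=> us /absum_leP uM; apply/ler_addgt0Pr => e e0.
have [F [finF /(_ F finF)]] := us _ e0; move=> /(_ (@subset_refl _ F)) lte.
have -> : s = \sum_(i \in F) u i - (\sum_(i \in F) u i - s).
  by rewrite opprB addrCA subrr addr0.
apply: le_trans (cnormD _ _) _; rewrite cnormN; apply: lerD; last exact: ltW.
by apply: le_trans (cnorm_fsum _ _) _; [|exact: uM].
Qed.

(** The difference [t - s] is a sum of the zero family [-u + u], whose absolute sum is at most 0. *)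
Lemma HasSum_unique u s t : HasSum u s -> HasSum u t -> s = t.
Proof.
move=> us ut; have st := HasSum_lin (-1) us ut.
suff : cnorm (-1 * s + t) <= 0.
  rewrite le_eqVlt ltNge cnorm_ge0 orbF cnorm_eq0 mulN1r addrC subr_eq0.
  by move=> /eqP.
apply: HasSum_norm st _; apply/absum_leP => F finF.
by rewrite fsbig1// => i _; rewrite mulN1r addNr cnorm0.
Qed.

End Summation.

(** * Monomials on the closed polydisc *)

Section Monomials.
Variable R : realType.
Implicit Types (al be : nat -> nat) (z w : nat -> R[i]).

Lemma mono_norm_le al z j : fin_supp al -> al j != 0%N -> cpolydisc z ->
  cnorm (mono al z) <= cnorm (z j) ^+ al j.
Proof.
move=> fal alj zD; rewrite /mono (fsbigD1 j)//= cnormM cnormX.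
rewrite ler_piMr ?exprn_ge0 ?cnorm_ge0//.
elim/big_ind: _ => [|x y x1 y1|i _]; first by rewrite cnorm1.
  by rewrite cnormM mulr_ile1 ?cnorm_ge0.
by rewrite cnormX exprn_ile1 ?cnorm_ge0.
Qed.

Definition unit_idx (j : nat) : nat -> nat := fun i => (i == j).

Lemma support_unit_idx (j : nat) : Defs.support (unit_idx j) = [set j].
Proof.
apply/seteqP; split=> i; rewrite /Defs.support/= /unit_idx eqb0 negbK.
  by move/eqP.
by move->.
Qed.

Lemma fin_supp_unit_idx j : fin_supp (unit_idx j).
Proof. by rewrite /fin_supp support_unit_idx; exact: finite_set1. Qed.

Lemma unit_idx_inj : injective unit_idx.
Proof.
move=> i j /(congr1 (fun f => f i)); rewrite /unit_idx eqxx.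
by case: (i =P j).
Qed.

Lemma mono_unit_idx j z : mono (unit_idx j) z = z j.
Proof. by rewrite /mono support_unit_idx fsbig_set1 /unit_idx eqxx expr1. Qed.

Lemma mono0 z : mono (fun=> 0%N) z = 1.
Proof.
rewrite /mono (_ : Defs.support _ = set0) ?fsbig_set0//.
by apply/seteqP; split=> i; rewrite /Defs.support/=.
Qed.

Lemma mono1 al : mono al (fun=> 1 : R[i]) = 1.
Proof. by rewrite /mono fsbig1// => i _; rewrite expr1n. Qed.

Lemma monoM al z w : fin_supp al ->
  mono al (fun j => z j * w j) = mono al z * mono al w.
Proof.
move=> fal; rewrite /mono -fsbig_split//.
by apply: eq_fsbigr => j _; rewrite exprMn.
Qed.

Lemma mono_norm1 al z : (forall j, cnorm (z j) = 1) -> cnorm (mono al z) = 1.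
Proof.
move=> z1; rewrite /mono; elim/big_ind: _ => [|x y x1 y1|j _].
- by rewrite cnorm1.
- by rewrite cnormM x1 y1 mulr1.
- by rewrite cnormX z1 expr1n.
Qed.

Lemma idx_neq0 al : al <> (fun=> 0%N) -> exists j, al j != 0%N.
Proof.
move=> al0; apply: contrapT => /forallNP H; apply: al0; apply/funext => j.
by apply/eqP; move/negP: (H j); rewrite negbK.
Qed.

End Monomials.

(** * Bohr's correspondence between multi-indices and integers *)

Section Bohr.

(** A strictly increasing sequence of primes, possibly with gaps; the correspondence relies only on
    their being distinct. *)
Fixpoint nth_prime n :=
  if n is m.+1 then s2val (prime_above (nth_prime m)) else 2%N.

Lemma prime_nth_prime n : prime (nth_prime n).
Proof. by case: n => [|n]//=; case: (prime_above _). Qed.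

Lemma nth_prime_inj : injective nth_prime.
Proof.
have mono m n : (m < n)%N -> (nth_prime m < nth_prime n)%N.
  apply: (homo_ltn ltn_trans) => k /=.
  by case: (prime_above _).
move=> m n; case: (ltngtP m n) => // /mono + e; by rewrite e ltnn.
Qed.

Definition bohr (al : nat -> nat) : nat :=
  \big[muln/1%N]_(j \in Defs.support al) (nth_prime j ^ al j)%N.

Lemma bohr_gt0 al : (0 < bohr al)%N.
Proof.
rewrite /bohr; elim/big_ind: _ => // [m n m0 n0|j _]; first by rewrite muln_gt0 m0.
by rewrite expn_gt0 prime_gt0 ?prime_nth_prime.
Qed.

Lemma logn_bohr al j : fin_supp al -> logn (nth_prime j) (bohr al) = al j.
Proof.
move=> fal; rewrite /bohr fsbig_finite//.
(* The support is generalised to a duplicate-free list to allow induction; only the factor at [j]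
   contributes to the valuation. *)
have logE s : uniq s ->
    logn (nth_prime j) (\big[muln/1%N]_(i <- s) (nth_prime i ^ al i)%N) =
    (if j \in s then al j else 0)%N.
  elim: s => [|i s IH]; first by rewrite big_nil logn1.
  move=> /= /andP[iNs us]; rewrite big_cons lognM; last 2 first.
  - by rewrite expn_gt0 prime_gt0 ?prime_nth_prime.
  - by apply: prodn_gt0 => k; rewrite expn_gt0 prime_gt0 ?prime_nth_prime.
  rewrite IH// lognX logn_prime ?prime_nth_prime// (inj_eq nth_prime_inj) inE.
  have [->|ji] := eqVneq j i; first by rewrite (negPf iNs) muln1 addn0.
  by rewrite muln0.
rewrite logE ?finmap.fset_uniq//; case: ifPn => //.
by rewrite in_fset_set// notin_setE /Defs.support/= => /negP; rewrite negbK => /eqP.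
Qed.

(** Unique factorisation: each exponent is recovered as a valuation. *)
Lemma bohr_inj al be : fin_supp al -> fin_supp be -> bohr al = bohr be -> al = be.
Proof.
by move=> fal fbe e; apply/funext => j; rewrite -logn_bohr// e logn_bohr.
Qed.

Lemma mono_bohr (R : realType) al s : fin_supp al ->
  mono al (fun j => (nth_prime j)%:R ^- s) = (bohr al)%:R ^- s :> R[i].
Proof.
move=> fal; rewrite /mono /bohr !fsbig_finite//.
elim/big_rec2: _ => [|j m x _ ->]; first by rewrite expr1n invr1.
by rewrite natrM natrX exprMn invfM exprVn -!exprM mulnC.
Qed.

End Bohr.

(** * Uniqueness of coefficients and the norm of the algebra *)

Section Coefficients.
Variable R : realType.
Implicit Types (a b : (nat -> nat) -> R[i]) (f g : (nat -> R[i]) -> R[i]).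

Lemma exp_small (q e : R) : 0 <= q < 1 -> 0 < e -> exists s, q ^+ s < e.
Proof.
move=> /andP[q0 q1] e0.
have /cvgrPdist_lt/(_ e e0)[s _ /(_ s (leqnn s))] :
  (q ^+ n : R) @[n --> \oo] --> (0 : R).
  by apply: cvg_expr; rewrite ger0_norm.
rewrite /= sub0r normrN ger0_norm ?exprn_ge0// => lt; by exists s.
Qed.

Lemma cnorm_nat n : cnorm (n%:R : R[i]) = n%:R.
Proof. by rewrite -(rmorph_nat (real_complex R)) cnorm_real. Qed.

(* Bohr's substitution [z_j = p_j ^ -s] turns the power series into the
   Dirichlet series with coefficient [a al] at [bohr al]; its leading term
   dominates as [s] grows. *)
Lemma represents0 a : coef_family a -> represents a (fun=> 0) ->
  forall al, a al = 0.
Proof.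
move=> [asupp /absum_finP[M M0 aM]] a0 be; apply: contrapT => abe.
have fs al : a al <> 0 -> fin_supp al.
  by move=> al0; apply: contrapT => /asupp.
(* The leading term is the one at [ga], whose Bohr number [N] is least among the indices with
   nonzero coefficient. *)
pose P n := `[< exists al, a al <> 0 /\ bohr al = n >].
have exP : exists n, P n by exists (bohr be); apply/asboolP; exists be.
case: (ex_minnP exP) => n /asboolP[ga [aga <-]] minP {exP}.
set N := bohr ga in minP; have N0 : (0 < N)%N := bohr_gt0 ga.
have cN0 : (N%:R : R[i]) != 0 by rewrite pnatr_eq0 -lt0n.
(* The largest ratio [N / n] over the integers [n > N]. *)
pose q : R := N%:R / N.+1%:R.
have q01 : 0 <= q < 1 by rewrite divr_ge0//= ltr_pdivrMr// mul1r ltr_nat.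
have qs s : cnorm (a ga) <= q ^+ s * M.
  pose z : nat -> R[i] := fun j => (nth_prime j)%:R ^- s.
  have zD : cpolydisc z.
    move=> j; rewrite /z cnormV cnormX cnorm_nat invf_le1 ?exprn_gt0//.
      by rewrite exprn_ege1// ler1n prime_gt0// prime_nth_prime.
    by rewrite ltr0n prime_gt0// prime_nth_prime.
  (* Scaling by [N ^ s] turns the leading term into [a ga], which is then removed; every remaining
     term carries a factor [(N / n) ^ s <= q ^ s]. *)
  have := HasSum_lin (N%:R ^+ s) (a0 z zD) (HasSum_delta ga (- a ga)).
  rewrite mulr0 add0r => sum0; rewrite -cnormN; apply: HasSum_norm sum0 _.
  have qs0 : 0 <= q ^+ s by rewrite exprn_ge0//; case/andP: q01.
  apply: (@absum_le _ _ a) => //; last by rewrite -aM.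
  move=> al; rewrite /delta; case: eqP => [->|alga].
    rewrite mono_bohr; last exact: fs.
    by rewrite mulrCA divff ?expf_neq0// mulr1 subrr cnorm0 mulr_ge0 ?cnorm_ge0.
  rewrite addr0; have [->|/eqP aal] := eqVneq (a al) 0.
    by rewrite mul0r mulr0 cnorm0 mulr0.
  have ltN : (N < bohr al)%N.
    rewrite ltn_neqAle minP ?andbT; last by apply/asboolP; exists al.
    by apply/eqP => e; apply: alga; apply: bohr_inj; [exact: fs|exact: fs|].
  rewrite mono_bohr; last exact: fs.
  rewrite mulrCA cnormM mulrC -exprVn -exprMn cnormX cnormM cnormV !cnorm_nat.
  rewrite ler_wpM2r ?cnorm_ge0// lerXn2r ?nnegrE ?divr_ge0//.
  by rewrite /q ler_wpM2l// lef_pV2 ?posrE ?ltr0n ?bohr_gt0// ler_nat.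
have aga0 : 0 < cnorm (a ga).
  by rewrite lt_neqAle cnorm_ge0 andbT eq_sym cnorm_eq0; apply/eqP.
(* For this [s], [q ^ s * (M + 1) < |a ga|], against [qs]; the [+ 1] keeps the divisor positive when
   [M = 0]. *)
have [s] := exp_small q01 (divr_gt0 aga0 (ltr_wpDl M0 ltr01)).
rewrite ltr_pdivlMr ?ltr_wpDl// ltNge => /negP; apply.
apply: le_trans (qs s) _; rewrite ler_wpM2l ?lerDl// exprn_ge0//.
by case/andP: q01.
Qed.

Lemma coef_family_lin c a b : coef_family a -> coef_family b ->
  coef_family (fun al => c * a al + b al).
Proof.
move=> [sa /absum_finP[M _ aM]] [sb /absum_finP[N _ bN]]; split=> [al fal|].
  by rewrite sa// sb// mulr0 addr0.
apply: le_lt_trans (absum_lin c _ _) (ltry (cnorm c * M + N)).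
  by rewrite aM.
by rewrite bN.
Qed.

Lemma represents_lin c a b f g : represents a f -> represents b g ->
  represents (fun al => c * a al + b al) (fun z => c * f z + g z).
Proof.
move=> af bg z zD; have := HasSum_lin c (af z zD) (bg z zD).
by congr HasSum; apply/funext => al; rewrite mulrDl mulrA.
Qed.

Lemma coef_family_delta al c : fin_supp al -> coef_family (delta al (c : R[i])).
Proof.
move=> fal; split=> [be fbe|].
  by rewrite /delta; case: eqP => // e; rewrite e in fbe.
by rewrite -/(absum (delta al c)) absum_delta ltry.
Qed.

Lemma represents_delta al c :
  represents (delta al (c : R[i])) (fun z => c * mono al z).
Proof.
move=> z _; have := HasSum_delta al (c * mono al z).
congr HasSum; apply/funext => be; rewrite /delta.
by case: eqP => [->|]//; rewrite mul0r.
Qed.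

Lemma represents_inj a b f : coef_family a -> coef_family b ->
  represents a f -> represents b f -> a = b.
Proof.
move=> ca cb af bf; apply/funext => al; apply/eqP; rewrite eq_sym -subr_eq0 addrC.
rewrite -mulN1r; apply/eqP; move: al.
apply: represents0; first exact: coef_family_lin.
have := represents_lin (-1) af bf.
by congr represents; apply/funext => z; rewrite mulN1r addNr.
Qed.

Lemma represents_eq a f g : represents a f -> represents a g ->
  forall z, cpolydisc z -> f z = g z.
Proof. by move=> af ag z zD; apply: HasSum_unique (af z zD) (ag z zD). Qed.

(** By uniqueness of coefficients the infimum runs over a single value. *)
Lemma Anorm_absum a f : coef_family a -> represents a f -> Anorm f = absum a.
Proof.
move=> ca af; rewrite /Anorm (_ : [set a | _] = [set a]) ?image_set1 ?ereal_inf1//.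
apply/seteqP; split=> [b [cb bf]|_ ->]//=.
exact: represents_inj bf af.
Qed.

Lemma Aplus_lin c f g : Aplus f -> Aplus g -> Aplus (fun z => c * f z + g z).
Proof.
move=> [a [ca af]] [b [cb bg]]; exists (fun al => c * a al + b al).
by split; [exact: coef_family_lin|exact: represents_lin].
Qed.

Lemma Aplus_mono al c : fin_supp al -> Aplus (fun z : nat -> R[i] => c * mono al z).
Proof.
move=> fal; exists (delta al c).
by split; [exact: coef_family_delta|exact: represents_delta].
Qed.

Lemma inB_cpolydisc (z : nat -> R[i]) : inB z -> cpolydisc z.
Proof. by move=> [zB _] j; exact/ltW. Qed.

(* The constant term is the only one that does not carry a factor bounded by [rho]. *)
Lemma represents_near0 a f w (rho M : R) : coef_family a -> represents a f ->
  (absum a <= M%:E)%E -> 0 <= rho <= 1 -> (forall j, cnorm (w j) <= rho) ->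
  cnorm (f w - a (fun=> 0%N)) <= rho * M.
Proof.
move=> ca af aM /andP[r0 r1] wr.
have wD : cpolydisc w by move=> j; exact: le_trans (wr j) r1.
have := HasSum_lin 1 (af w wD) (HasSum_delta (fun=> 0%N) (- a (fun=> 0%N))).
rewrite mul1r => sumw; apply: HasSum_norm sumw _.
apply: (@absum_le _ _ a) => // al.
rewrite mul1r /delta; case: eqP => [->|/idx_neq0[j alj]].
  by rewrite mono0 mulr1 subrr cnorm0 mulr_ge0 ?cnorm_ge0.
rewrite addr0 cnormM mulrC; have [fal|nal] := pselect (fin_supp al); last first.
  by rewrite (proj1 ca)// cnorm0 !mulr0.
rewrite ler_wpM2r ?cnorm_ge0//; apply: le_trans (mono_norm_le fal alj wD) _.
apply: le_trans (wr j); rewrite -[leRHS]expr1.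
by rewrite ler_wiXn2l ?cnorm_ge0 ?lt0n.
Qed.

End Coefficients.

(** * Extreme points of the unit ball of [l^1] *)

Section ExtremePoints.
Variables (R : realType) (I : choiceType).
Implicit Types u v : I -> R[i].

(** The entry at [k] and the rest have disjoint supports, so their norms add with equality. *)
Lemma absum_split u k :
  absum u = ((cnorm (u k))%:E + absum (fun i => -1 * delta k (u k) i + u i)%R)%E.
Proof.
rewrite -(absum_delta k) /absum -esumD; last 2 first.
- by move=> i _; rewrite lee_fin cnorm_ge0.
- by move=> i _; rewrite lee_fin cnorm_ge0.
apply: eq_esum => i _; rewrite -EFinD /delta; case: eqP => [->|_].
  by rewrite mulN1r addNr cnorm0 addr0.
by rewrite mulr0 add0r cnorm0 add0r.
Qed.

(* The unit vectors [delta k 1] are extreme points of the unit ball of [l^1]. *)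
Lemma delta_extreme u v k : (forall i, u i + v i = delta k 1 i) ->
  (absum u + absum v <= 1)%E -> u = delta k (u k).
Proof.
move=> uv; rewrite -esumD; last 2 first.
- by move=> i _; rewrite lee_fin cnorm_ge0.
- by move=> i _; rewrite lee_fin cnorm_ge0.
move=> le1; apply/funext => i; rewrite /delta; case: eqP => [->//|/eqP ik].
have : (\sum_(j \in [set k; i]) (cnorm (u j) + cnorm (v j))%:E <= 1)%E.
  by apply: le_trans le1; apply: esum_ge; exists [set k; i].
rewrite (fsbigD1 k)//=; last by left.
rewrite (_ : [set k; i] `\ k = [set i]); last first.
  apply/seteqP; split=> [j [[]]//|j ->]; split; first by right.
  by apply/eqP.
rewrite fsbig_set1 -EFinD lee_fin => le; apply/eqP.
rewrite -cnorm_eq0 eq_le cnorm_ge0 andbT.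
(* The entry at [k] already uses up the whole bound 1, leaving nothing for [i]. *)
have uvk : 1 <= cnorm (u k) + cnorm (v k).
  by have := cnormD (u k) (v k); rewrite uv /delta eqxx cnorm1.
have := cnorm_ge0 (v i); move: le uvk; lra.
Qed.

End ExtremePoints.

(** * Test points and renaming of variables *)

Lemma represents_ext (R : realType) a (f g : (nat -> R[i]) -> R[i]) :
  (forall z, cpolydisc z -> f z = g z) -> represents a f -> represents a g.
Proof. by move=> fg af z zD; rewrite -fg//; exact: af. Qed.

Lemma inB_scaled_unit (R : realType) (j : nat) (r : R) : 0 <= r < 1 ->
  inB (fun i => if i == j then (r%:C)%C else 0).
Proof.
move=> /andP[r0 r1]; split=> [i|e e0].
  by case: ifP; rewrite ?cnorm0 ?ltr01// cnorm_real.
exists j.+1 => i ji; rewrite ifN ?cnorm0//.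
by apply: contraTneq ji => ->; rewrite ltnn.
Qed.

(** The multi-index is pushed forward along [tau]: [be (tau j) = al j], and [be] is 0 off the range
    of [tau]. *)
Lemma mono_comp (R : realType) (tau : nat -> nat) al : injective tau ->
  fin_supp al -> exists2 be, fin_supp be &
    forall z : nat -> R[i], mono be z = mono al (z \o tau).
Proof.
move=> tau_inj fal.
(* [rho] is the partial inverse of [tau], with [None] off its range. *)
have /choice[rho rhoK] : forall k, exists o : option nat,
    if o is Some j then tau j = k else forall j, tau j <> k.
  move=> k.
  have [[j jk]|/forallNP nk] := pselect (exists j, tau j = k).
    by exists (Some j).
  by exists None.
pose be k := if rho k is Some j then al j else 0%N.
have betau j : be (tau j) = al j.
  rewrite /be; case: (rho (tau j)) (rhoK (tau j)) => [i /tau_inj->//|/(_ j)].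
  by [].
have suppE : Defs.support be = tau @` Defs.support al.
  apply/seteqP; split=> [k|_ [j alj <-]]; rewrite /Defs.support/=; last by rewrite betau.
  by rewrite /be; case: (rho k) (rhoK k) => // j jk alj; exists j.
exists be; first by rewrite /fin_supp suppE; exact: finite_image.
move=> z; rewrite /mono suppE fsbig_image; last by move=> i j _ _ /tau_inj.
by apply: eq_fsbigr => j _; rewrite betau.
Qed.

(** * Isometric automorphisms permute and rotate the coordinates *)

Unset Implicit Arguments.
Set Strict Implicit.

Theorem theorem21 (R : realType) (phi : (nat -> R[i]) -> (nat -> R[i]))
  (* phi : B -> B analytic *)
  (phiB : forall z, inB z -> inB (phi z))
  (phi_holo : holo_B phi)
  (* C_phi maps A^+ into A^+ *)
  (Cphi_maps : forall f, Aplus f ->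
     exists g, Aplus g /\ forall z, inB z -> g z = f (phi z))
  (* C_phi is isometric *)
  (Cphi_isom : forall f g, Aplus f -> Aplus g ->
     (forall z, inB z -> g z = f (phi z)) -> Anorm g = Anorm f)
  (* C_phi is injective *)
  (Cphi_inj : forall f1 f2, Aplus f1 -> Aplus f2 ->
     (forall z, inB z -> f1 (phi z) = f2 (phi z)) ->
     forall z, cpolydisc z -> f1 z = f2 z)
  (* C_phi is onto A^+ *)
  (Cphi_onto : forall g, Aplus g ->
     exists f, Aplus f /\ forall z, inB z -> g z = f (phi z)) :
  exists (sigma : nat -> nat) (eps : nat -> R[i]),
    bijective sigma /\ (forall j, cnorm (eps j) = 1) /\
    forall z, inB z -> phi z = (fun j => eps j * z (sigma j)).
Proof.
pose Z j c : (nat -> R[i]) -> R[i] := fun z => c * mono (unit_idx j) z.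
have AZ j c : Aplus (Z j c) by apply: Aplus_mono; exact: fin_supp_unit_idx.
have ZE j c z : Z j c z = c * z j by rewrite /Z mono_unit_idx.
have phi_mono j : exists be eps, [/\ fin_supp be, cnorm eps = 1 &
    forall z, inB z -> phi z j = eps * mono be z].
  have [g [Ag gE]] := Cphi_maps _ (AZ j 1).
  have [a [ca ag]] := Ag.
  have absum_a : absum a = 1%E.
    rewrite -(Anorm_absum ca ag) (Cphi_isom _ _ (AZ j 1) Ag gE).
    rewrite (Anorm_absum _ (represents_delta _ _)) ?absum_delta ?cnorm1//.
    by apply: coef_family_delta; exact: fin_supp_unit_idx.
  have [be abe] : exists be, a be <> 0.
    apply: contrapT => /forallNP a0; move: absum_a; rewrite /absum esum1 => [|al _].
      by move/eqP; rewrite eq_sym onee_eq0.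
    by move/contrapT: (a0 al) => ->; rewrite cnorm0.
  have fbe : fin_supp be by apply: contrapT => /(proj1 ca).
  (* The image [g] of [z_j] is split into one nonzero term and the rest; the two norms add up to 1,
     and so do those of the preimages [f1] and [f2]. *)
  pose g1 z := a be * mono be z; pose g2 z := -1 * g1 z + g z.
  have Ag1 : Aplus g1 by exact: Aplus_mono.
  have Ag2 : Aplus g2 by exact: Aplus_lin.
  have [f1 [Af1 f1E]] := Cphi_onto _ Ag1.
  have [f2 [Af2 f2E]] := Cphi_onto _ Ag2.
  have [b1 [cb1 bf1]] := Af1; have [b2 [cb2 bf2]] := Af2.
  have nb1 : absum b1 = (cnorm (a be))%:E.
    rewrite -(Anorm_absum cb1 bf1) -(Cphi_isom _ _ Af1 Ag1 f1E).
    rewrite (Anorm_absum _ (represents_delta _ _)) ?absum_delta//.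
    exact: coef_family_delta.
  have nb2 : absum b2 = absum (fun al => -1 * delta be (a be) al + a al)%R.
    rewrite -(Anorm_absum cb2 bf2) -(Cphi_isom _ _ Af2 Ag2 f2E).
    rewrite (Anorm_absum _ (represents_lin (-1) (represents_delta _ _) ag))//.
    by apply: coef_family_lin => //; exact: coef_family_delta.
  (* Injectivity: [f1 + f2] and [z_j] have the same image [g1 + g2 = g]. *)
  have f12 : forall z, cpolydisc z -> 1 * f1 z + f2 z = Z j 1 z.
    apply: (Cphi_inj (fun z => 1 * f1 z + f2 z) (Z j 1)) => //; first exact: Aplus_lin.
    move=> z zB; rewrite -f1E// -f2E// -gE// /g2.
    by rewrite mul1r mulN1r addrA subrr add0r.
  have b12 : (fun al => 1 * b1 al + b2 al) = delta (unit_idx j) 1.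
    apply: (@represents_inj _ _ _ (Z j 1)).
    - exact: coef_family_lin.
    - by apply: coef_family_delta; exact: fin_supp_unit_idx.
    - by apply: represents_ext f12 _; exact: represents_lin.
    - exact: represents_delta.
  (* Extremality of [z_j] forces [f1] to be a multiple [c z_j]; its image is the single term [g1],
     whence the formula for [phi_j] after division by [c]. *)
  have b1E : b1 = delta (unit_idx j) (b1 (unit_idx j)).
    apply: (@delta_extreme _ _ b1 b2) => [al|].
      by rewrite -b12 mul1r.
    by rewrite nb1 nb2 -absum_split absum_a.
  set c := b1 (unit_idx j) in b1E.
  have nc : cnorm c = cnorm (a be).
    by move: nb1; rewrite b1E absum_delta => -[].
  have c0 : c != 0 by rewrite -cnorm_eq0 nc cnorm_eq0; apply/eqP.
  exists be, (c^-1 * a be); split=> // [|z zB].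
    by rewrite cnormM cnormV nc mulVf// cnorm_eq0; apply/eqP.
  rewrite -mulrA -/(g1 z) f1E//.
  have -> : f1 (phi z) = Z j c (phi z).
    apply: (@represents_eq _ b1) => //; last exact/inB_cpolydisc/phiB.
    by rewrite b1E; exact: represents_delta.
  by rewrite ZE mulrA mulVf// mul1r.
have [be /choice[eps phiE]] := choice phi_mono.
have fbe i : fin_supp (be i) by case: (phiE i).
have eps1 i : cnorm (eps i) = 1 by case: (phiE i).
have {phiE} phiE i z : inB z -> phi z i = eps i * mono (be i) z.
  by case: (phiE i) => _ _; apply.
have eps0 i : eps i != 0 by rewrite -cnorm_eq0 eps1 oner_eq0.
have B0 : inB (fun=> 0 : R[i]).
  split=> [i|e e0]; first by rewrite cnorm0 ltr01.
  by exists 0%N => i _; rewrite cnorm0.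
(* A constant [phi_i] would have modulus 1 at the origin, outside [B]. *)
have be0 i : be i <> (fun=> 0%N).
  move=> bei; have [/(_ i)] := phiB _ B0.
  by rewrite phiE// bei mono0 mulr1 eps1 ltxx.
(* Otherwise [phi] maps [r e_j] into the ball of radius [r ^ 2], and a preimage
   of [z_j] would be [O(r ^ 2)] there instead of [r]. *)
have surj j : exists i, be i = unit_idx j.
  apply: contrapT => /forallNP nbe.
  have [f [Af fE]] := Cphi_onto _ (AZ j 1).
  have [b [cb bf]] := Af.
  have [M M0 bM] := absum_finP (proj2 cb); rewrite -/(absum b) in bM.
  have bleM : (absum b <= M%:E)%E by rewrite bM.
  have small r : 0 <= r < 1 -> r <= r ^+ 2 * M + cnorm (b (fun=> 0%N)).
    move=> r01; have /andP[r0 r1] := r01.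
    have zB := inB_scaled_unit j r01.
    set z := (fun i => _) in zB; have zD := inB_cpolydisc zB.
    have le i : cnorm (phi z i) <= r ^+ 2.
      rewrite phiE// cnormM eps1 mul1r.
      (* At [r e_j] the monomial vanishes if it involves another variable; otherwise it is a power
         of [z_j] whose exponent, being neither 0 nor 1, is at least 2. *)
      have [[k kj bek]|nk] := pselect (exists2 k, k <> j & be i k != 0%N).
        apply: le_trans (mono_norm_le (fbe i) bek zD) _.
        by rewrite /z; case: eqP => // _; rewrite cnorm0 expr0n (negPf bek) exprn_ge0.
      have bei k : k <> j -> be i k = 0%N.
        by move=> kj; apply: contrapT => /eqP bek; apply: nk; exists k.
      have bej : (1 < be i j)%N.
        rewrite ltnNge leq_eqVlt ltnS leqn0; apply/negP => /orP[] /eqP bej.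
          apply: (nbe i); apply/funext => k; rewrite /unit_idx.
          by case: eqP => [->|/bei].
        by apply: (be0 i); apply/funext => k; have [->|/eqP/bei] := eqVneq k j.
      have := mono_norm_le (fbe i) (lt0n_neq0 (ltnW bej)) zD.
      move=> /le_trans; apply; rewrite /z eqxx cnorm_real//.
      by rewrite ler_wiXn2l// ltW.
    have r2 : 0 <= r ^+ 2 <= 1 by rewrite exprn_ge0// exprn_ile1// ltW.
    have := represents_near0 cb bf bleM r2 le.
    rewrite -fE// ZE mul1r /z eqxx => le2.
    have := cnormD ((r%:C)%C - b (fun=> 0%N)) (b (fun=> 0%N)).
    by rewrite subrK cnorm_real// => /le_trans; apply; rewrite lerD2r.
  (* No [be i] is zero, so [phi] fixes the origin; the estimate with radius 0 then equates the
     constant term with [f (phi 0) = 0]. *)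
  have b0 : b (fun=> 0%N) = 0.
    have phi0 i : cnorm (phi (fun=> 0) i) <= 0.
      have [k bek] := idx_neq0 (@be0 i).
      rewrite phiE// cnormM eps1 mul1r.
      apply: le_trans (mono_norm_le (fbe i) bek (inB_cpolydisc B0)) _.
      by rewrite cnorm0 expr0n (negPf bek).
    have r01 : 0 <= (0 : R) <= 1 by rewrite lexx ler01.
    have := represents_near0 cb bf bleM r01 phi0.
    rewrite -fE// ZE mulr0 mul0r sub0r cnormN le_eqVlt ltNge cnorm_ge0 orbF.
    by rewrite cnorm_eq0 => /eqP.
  (* With [r = 1 / (M + 2)], which is below 1 even for [M = 0], the bound [r <= r ^ 2 * M] would
     give [M + 2 <= M]. *)
  have M2 : 0 < M + 2 by rewrite ltr_wpDl.
  have r01 : 0 <= (M + 2)^-1 < 1.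
    by rewrite invr_ge0 ltW//= invf_lt1//; move: M0; lra.
  have := small _ r01; rewrite b0 cnorm0 addr0 expr2 -mulrA.
  rewrite -[leLHS]mulr1 ler_pM2l ?invr_gt0// ler_pdivlMl// mulr1.
  by lra.
have be_inj i i' : be i = be i' -> i = i'.
  move=> bei; apply: contrapT => ii'.
  (* A repetition makes [phi_i] and [phi_i'] proportional, hence also [z_i] and [z_i'] by
     injectivity; the point [e_i] refutes this. *)
  have zE z : cpolydisc z -> Z i 1 z = Z i' (eps i / eps i') z.
    apply: Cphi_inj => // {}z zB.
    by rewrite !ZE mul1r !phiE// bei mulrA divfK.
  have wD : cpolydisc (fun k => (k == i)%:R : R[i]).
    by move=> k; case: (k == i); rewrite ?cnorm0 ?cnorm1.
  move/zE: wD; rewrite !ZE eqxx.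
  have /eqP/negPf -> : i' <> i by move=> e; apply: ii'.
  by move/eqP; rewrite mulr1 mulr0 oner_eq0.
have [tau tauE] := choice surj.
have tau_inj : injective tau.
  by move=> j j' e; apply: unit_idx_inj; rewrite -!tauE e.
have total i : exists j, tau j = i.
  apply: contrapT => /forallNP ntau.
  (* Otherwise [C_phi] maps [z_i] and a multiple of the monomial [be i] in the variables
     [z_(tau j)] to the same function, but the latter does not
     depend on [z_i]. *)
  have [be' fbe' be'E] := @mono_comp R tau (be i) tau_inj (fbe i).
  (* Since [phi_(tau j) = eps_(tau j) z_j], the image of [mono be'] is [d z^(be i)]; the factor
     [eps i / d] turns it into [phi_i]. *)
  set d := mono (be i) (eps \o tau).
  have d1 : cnorm d = 1 by apply: mono_norm1 => j; exact: eps1.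
  have d0 : d != 0 by rewrite -cnorm_eq0 d1 oner_eq0.
  have zE z : cpolydisc z -> Z i 1 z = eps i / d * mono be' z.
    apply: (Cphi_inj _ (fun z => eps i / d * mono be' z)) => //.
      exact: Aplus_mono.
    move=> {}z zB; rewrite ZE mul1r be'E phiE//.
    have -> : phi z \o tau = fun j => (eps \o tau) j * z j.
      by apply/funext => j /=; rewrite phiE// tauE mono_unit_idx.
    by rewrite monoM// -/d mulrA divfK.
  (* At the point with [i]-th coordinate 0 and all others 1, [z_i] vanishes while the monomial
     equals 1. *)
  have wD : cpolydisc (fun k => (k != i)%:R : R[i]).
    by move=> k; case: (k != i); rewrite ?cnorm0 ?cnorm1.
  move/zE: wD; rewrite ZE eqxx mulr0 be'E.
  have -> : (fun k => (k != i)%:R) \o tau = (fun=> 1) :> (nat -> R[i]).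
    by apply/funext => j /=; have /eqP -> := ntau j.
  by move/eqP; rewrite mono1 mulr1 eq_sym mulf_eq0 invr_eq0 (negPf d0) (negPf (eps0 i)).
(* [sigma] inverts [tau], so [be i = be (tau (sigma i))] is the index of [z_(sigma i)]. *)
have [sigma sigmaE] := choice total.
exists sigma, eps; split; first by exists tau => // j; apply: tau_inj.
split=> // z zB; apply/funext => i.
by rewrite phiE// -[in be i](sigmaE i) tauE mono_unit_idx.
Qed.
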